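(* Let $\mathbb{H},\mathbb{H}'$ be complete Heyting algebras and let $f:\mathbb{H}\to\mathbb{H}'$ be a function preserving arbitrary suprema and finite infima. Let $\tilde f\subseteq V^{(\mathbb{H})}\times V^{(\mathbb{H}')}$ be the relation defined in the context. Then for all $\langle x,x'\rangle,\langle y,y'\rangle,\langle z,z'\rangle\in\tilde f$, $$f\big([\![y\in x]\!]\big)\leq[\![y'\in x']\!]'\qquad\text{and}\qquad f\big([\![x=z]\!]\big)\leq[\![x'=z']\!]',$$ where $\leq$ is the order of $\mathbb{H}'$.
   Context: For a complete Heyting algebra $\mathbb{H}$, define by recursion on ordinals $V^{(\mathbb{H})}_\alpha=\{x : x \text{ is a function from a set } X \text{ to } \mathbb{H},\ X\subseteq V^{(\mathbb{H})}_\beta \text{ for some } \beta<\alpha\}$, and $V^{(\mathbb{H})}=\bigcup_{\alpha} V^{(\mathbb{H})}_\alpha$. The rank of $x\in V^{(\mathbb{H})}$ is $\varrho(x)=\min\{\alpha : x\in V^{(\mathbb{H})}_\alpha\}$; for $u\in\mathrm{dom}(x)$ one has $\varrho(u)<\varrho(x)$. For $x,y\in V^{(\mathbb{H})}$ define, by simultaneous well-founded recursion, $$[\![x\in y]\!]=\bigvee_{u\in\mathrm{dom}(y)} y(u)\wedge[\![x=u]\!],\qquad [\![x=y]\!]=\bigwedge_{v\in\mathrm{dom}(x)}\big(x(v)\to[\![v\in y]\!]\big)\wedge\bigwedge_{u\in\mathrm{dom}(y)}\big(y(u)\to[\![u\in x]\!]\big).$$ The class $V^{(\mathbb{H}')}$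 and its valuation, written $[\![\cdot]\!]'$, are defined in the same way from $\mathbb{H}'$. Definition of $\tilde f$ (by recursion on the rank of $x$): for an ordinal $\alpha$, $x\in V^{(\mathbb{H})}_\alpha$ and $y'\in V^{(\mathbb{H}')}$, $\langle x,y'\rangle\in\tilde f_\alpha$ if and only if there are $x'\in V^{(\mathbb{H}')}$ with $[\![x'=y']\!]'=1$ and a surjection $\varepsilon:\mathrm{dom}(x)\to\mathrm{dom}(x')$ such that $\langle u,\varepsilon(u)\rangle\in\tilde f_{\varrho(x)}$ for all $u\in\mathrm{dom}(x)$, and $x'\circ\varepsilon=f\circ x$. Put $\tilde f=\bigcup_\alpha\tilde f_\alpha$, the union over all ordinals. *)

(* Defs.v *)
From HB Require Import structures.
From mathcomp Require Import all_boot all_order.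
From mathcomp Require Import boolp classical_sets cardinality.

Set Implicit Arguments.
Unset Strict Implicit.
Unset Printing Implicit Defensive.

Import Order.TTheory.

Local Open Scope classical_set_scope.
Local Open Scope order_scope.

HB.mixin Record isCompleteHeyting (d : Order.disp_t) T & Order.TBLattice d T := {
  bigjoin : set T -> T;
  bigmeet : set T -> T;
  himp : T -> T -> T;
  bigjoinP : forall A : set T, supremums A (bigjoin A);
  bigmeetP : forall A : set T, infimums A (bigmeet A);
  himpP : forall a b c : T, (c <= himp a b) = (Order.meet c a <= b)
}.

#[short(type="completeHeytingType")]
HB.structure Definition CompleteHeyting (d : Order.disp_t) :=
  { T of Order.TBLattice d T & isCompleteHeyting d T }.

Definition preserves_sups d d' (H : completeHeytingType d)
    (H' : completeHeytingType d') (f : H -> H') : Prop :=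
  forall A : set H, f (bigjoin A) = bigjoin (f @` A).

(* The case A = set0 says that f preserves the top element. *)
Definition preserves_finite_infs d d' (H : completeHeytingType d)
    (H' : completeHeytingType d') (f : H -> H') : Prop :=
  forall A : set H, finite_set A -> f (bigmeet A) = bigmeet (f @` A).

(* Ordinals as well-founded trees: Ord a denotes the least ordinal strictly
   above all the a i.  Distinct trees may denote the same ordinal, i.e.,
   ordinals are compared with ord_le and ord_lt, never with =. *)
Inductive ord : Type := Ord (X : Type) (a : X -> ord).

HB.instance Definition _ := gen_eqMixin ord.
HB.instance Definition _ := gen_choiceMixin ord.

Definition ord_zero : ord := Ord (fun e : Empty_set => match e with end).

Fixpoint ord_le (a b : ord) : Prop :=
  match a, b with
  | Ord X a, Ord Y b => forall i : X, exists j : Y, ord_le (a i) (b j)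
  end.

Definition ord_lt (a b : ord) : Prop :=
  match b with Ord Y b => exists j : Y, ord_le a (b j) end.

(* Sets of names are families indexed by an arbitrary type in a fixed universe,
   over which the type of prenames lies.
   A prename presents the set of pairs (elem i, coef i), i : dom x, of a
   prename and a truth value.  Prenames presenting the same set-theoretic
   object are related by same_name, which need not be the equality of Rocq. *)
Inductive prename (H : Type) : Type :=
  PreName (X : Type) (u : X -> prename H) (h : X -> H).

Definition dom (H : Type) (x : prename H) : Type :=
  match x with PreName X _ _ => X end.

Definition elem (H : Type) (x : prename H) : dom x -> prename H :=
  match x with PreName _ u _ => u end.

Definition coef (H : Type) (x : prename H) : dom x -> H :=
  match x with PreName _ _ h => h end.

Fixpoint same_name (H : Type) (x y : prename H) {struct x} : Prop :=
  (forall i : dom x, exists2 j : dom y,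
      same_name (elem i) (elem j) & coef i = coef j) /\
  (forall j : dom y, exists2 i : dom x,
      same_name (elem i) (elem j) & coef i = coef j).

(* Each element of the domain is listed exactly once: the presented set of
   pairs is then a function, and dom x is a copy of its domain. *)
Definition functional_name (H : Type) (x : prename H) : Prop :=
  forall i j : dom x, same_name (elem i) (elem j) -> i = j.

(* stage x a : x belongs to V_a. *)
Fixpoint stage (H : Type) (x : prename H) (a : ord) {struct x} : Prop :=
  functional_name x /\
  exists2 b : ord, ord_lt b a & forall i : dom x, stage (elem i) b.

(* The class V = \bigcup_a V_a. *)
Definition is_name (H : Type) (x : prename H) : Prop :=
  exists a : ord, stage x a.

(* The least a such that x belongs to V_a (a representative of it). *)
Definition name_rank (H : Type) (x : prename H) : ord :=
  xget ord_zero [set a | stage x a /\ forall b, stage x b -> ord_le a b].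

Section Valuation.
Variables (d : Order.disp_t) (H : completeHeytingType d).
Implicit Types x y : prename H.

(* The recursive calls are all of the form [elem of x = elem of y], so that the
   recursion is structural in x.  In the second conjunct the usual clause uses
   the reversed equation [elem of y = elem of x]; see val_eqE below. *)
Fixpoint val_eq x y {struct x} : H :=
  Order.meet
    (bigmeet (range (fun i : dom x =>
       himp (coef i) (bigjoin (range (fun j : dom y =>
         Order.meet (coef j) (val_eq (elem i) (elem j))))))))
    (bigmeet (range (fun j : dom y =>
       himp (coef j) (bigjoin (range (fun i : dom x =>
         Order.meet (coef i) (val_eq (elem i) (elem j)))))))).

Definition val_mem x y : H :=
  bigjoin (range (fun j : dom y => Order.meet (coef j) (val_eq x (elem j)))).

Lemma val_eqC x y : val_eq x y = val_eq y x.
Proof.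
elim: x y => X u IHu h [Y v k] /=; rewrite meetC.
by congr (Order.meet (bigmeet _) (bigmeet _)); apply: eq_imagel => i _;
  congr (himp _ (bigjoin _)); apply: eq_imagel => j _; rewrite IHu.
Qed.

Lemma val_eqE x y :
  val_eq x y =
  Order.meet
    (bigmeet (range (fun i : dom x => himp (coef i) (val_mem (elem i) y))))
    (bigmeet (range (fun j : dom y => himp (coef j) (val_mem (elem j) x)))).
Proof.
case: x y => X u h [Y v k] /=.
congr (Order.meet _ (bigmeet _)); apply: eq_imagel => j _.
by congr (himp _ (bigjoin _)); apply: eq_imagel => i _ /=; rewrite val_eqC.
Qed.

End Valuation.

Section Ftilde.
Variables (d d' : Order.disp_t).
Variables (H : completeHeytingType d) (H' : completeHeytingType d').
Variable f : H -> H'.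

(* ftilde_at x a y' : (x, y') belongs to \tilde f_a.  The recursion on the rank
   of x is rendered as a structural recursion on x; see name_rank_elem below. *)
Fixpoint ftilde_at (x : prename H) (a : ord) (y' : prename H') {struct x} : Prop :=
  [/\ stage x a, is_name y' &
      exists x' : prename H',
        [/\ is_name x', val_eq x' y' = \top &
            exists e : dom x -> dom x',
              [/\ forall i' : dom x', exists i : dom x, e i = i',
                  forall i : dom x, ftilde_at (elem i) (name_rank x) (elem (e i)) &
                  forall i : dom x, coef (e i) = f (coef i)]]].

Definition ftilde (x : prename H) (y' : prename H') : Prop :=
  exists a : ord, ftilde_at x a y'.

End Ftilde.

Lemma ord_le_refl a : ord_le a a.
Proof. by elim: a => X a IH i; exists i; apply: IH. Qed.

Lemma ord_le_trans a b c : ord_le a b -> ord_le b c -> ord_le a c.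
Proof.
elim: a b c => X a IH [Y b] [Z c] ab bc i.
by have [j /IH abj] := ab i; have [k /abj] := bc j; exists k.
Qed.

Lemma ord_lt_le_trans a b c : ord_lt a b -> ord_le b c -> ord_lt a c.
Proof.
case: b c => Y b [Z c] [j abj] bc.
by have [k bck] := bc j; exists k; apply: ord_le_trans bck.
Qed.

Lemma ord_leVlt a b : ord_le a b \/ ord_lt b a.
Proof.
elim: a b => X a IH [Y b].
have [|nab] := EM (ord_le (Ord a) (Ord b)); [by left|right].
have [i nabi] : exists i, ~ ord_lt (a i) (Ord b) by apply/existsNP.
exists i; case: (a i) (IH i) nabi => Z c IHi nabi j.
by have [cb|//] := IHi (b j); case: nabi; exists j.
Qed.

Lemma ord_lt_wf : well_founded ord_lt.
Proof.
move=> a; elim: a {-2}a (ord_le_refl a) => X a IH [Y b] ba.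
constructor=> c [j cb]; have [i bai] := ba j.
by apply: (IH i); apply: ord_le_trans bai.
Qed.

Lemma ord_ltW a b : ord_lt a b -> ord_le a b.
Proof.
elim: a b => X a IH [Y b] [j aj] i; exists j; apply: IH.
by case: (b j) aj => Z c; apply.
Qed.

Lemma stage_le (H : Type) (x : prename H) a b :
  stage x a -> ord_le a b -> stage x b.
Proof.
case: x => X u h [funx [c ca uc]] ab; split=> //.
by exists c => //; apply: ord_lt_le_trans ab.
Qed.

(* The minimum in the definition of the rank exists. *)
Lemma name_rankP (H : Type) (x : prename H) : is_name x ->
  stage x (name_rank x) /\ forall b, stage x b -> ord_le (name_rank x) b.
Proof.
move=> [a]; elim/(well_founded_ind ord_lt_wf): a => a IH xa.
have [[b ba xb]|nb] := EM (exists2 b, ord_lt b a & stage x b).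
  exact: IH ba xb.
apply: (@xgetPex _ ord_zero
  [set a | stage x a /\ forall b, stage x b -> ord_le a b]).
exists a; split=> // b xb; have [//|ba] := ord_leVlt a b.
by case: nb; exists b.
Qed.

Lemma is_nameE (H : Type) (x : prename H) :
  is_name x <-> functional_name x /\ forall i : dom x, is_name (elem i).
Proof.
split; case: x => X u h /=.
  by move=> [a [funx [b _ ub]]]; split=> // i; exists b; apply: ub.
move=> [funx /choice[a ua]].
exists (Ord (fun _ : unit => Ord a)); split=> //.
exists (Ord a) => [|i]; first by exists tt; apply: ord_le_refl.
by apply: stage_le (ua i) _; apply: ord_ltW; exists i; apply: ord_le_refl.
Qed.

Lemma name_rank_elem (H : Type) (x : prename H) (i : dom x) :
  is_name x -> ord_lt (name_rank (elem i)) (name_rank x).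
Proof.
move=> xV; have /is_nameE[_ /(_ i) uV] := xV.
have [+ _] := name_rankP xV; move: (name_rank x) => r.
case: x i uV {xV} => X u h i uV [_ [b br /(_ i) ub]].
have [_ /(_ _ ub) rb] := name_rankP uV.
by case: r br => Y r [j brj]; exists j; apply: ord_le_trans brj.
Qed.

(* Main.v *)
(** By induction on the names.  Since [f] is monotone and commutes with joins
    and binary meets, it can be pushed through the clauses defining the
    valuation, down to equations between elements of the names.  The
    surjections in the definition of [ftilde] match these with the elements of
    names [x''] and [z''] which equal [x'] and [z'] with value [\top];
    transitivity of the valuation of [=] then replaces [x''] by [x'] and [z'']
    by [z']. *)
Require Import Defs.
From mathcomp Require Import all_boot all_order.
From mathcomp Require Import boolp classical_sets cardinality.

Set Implicit Arguments.
Unset Strict Implicit.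
Unset Printing Implicit Defensive.

Import Order.TTheory.

Local Open Scope classical_set_scope.
Local Open Scope order_scope.

Section CompleteHeytingTheory.
Variables (d : Order.disp_t) (H : completeHeytingType d).
Implicit Types (a b c : H) (A : set H).

Lemma bigjoin_ub A a : A a -> a <= bigjoin A.
Proof. by have [/(_ a)] := bigjoinP A. Qed.

Lemma bigjoin_le A c : (forall a, A a -> a <= c) -> bigjoin A <= c.
Proof. by have [_ /(_ c)] := bigjoinP A. Qed.

Lemma bigmeet_lb A a : A a -> bigmeet A <= a.
Proof. by have [/(_ a)] := bigmeetP A. Qed.

Lemma le_bigmeet A c : (forall a, A a -> c <= a) -> c <= bigmeet A.
Proof. by have [_ /(_ c)] := bigmeetP A. Qed.

(** Meeting with [b] has the right adjoint [himp b], so it distributes over arbitrary joins. *)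
Lemma bigjoin_meet_le A b c :
  (forall a, A a -> Order.meet a b <= c) -> Order.meet (bigjoin A) b <= c.
Proof.
by move=> Abc; rewrite -himpP; apply: bigjoin_le => a /Abc; rewrite himpP.
Qed.

Lemma bigmeet_pair a b : bigmeet [set a; b] = Order.meet a b.
Proof.
apply/le_anti/andP; split.
  by rewrite lexI !bigmeet_lb //; [right|left].
by apply: le_bigmeet => c [->|->]; [apply: leIl|apply: leIr].
Qed.

End CompleteHeytingTheory.

Section ValuationTheory.
Variables (d : Order.disp_t) (H : completeHeytingType d).
Implicit Types (x y z w : prename H) (c : H).

Lemma le_val_mem w y (j : dom y) c :
  c <= coef j -> c <= val_eq w (elem j) -> c <= val_mem w y.
Proof.
move=> cj cw; apply: (@le_trans _ _ (Order.meet (coef j) (val_eq w (elem j)))).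
  by rewrite lexI cj.
by apply: bigjoin_ub; exists j.
Qed.

(** Elimination rule for membership: by distributivity one may fix a witness [j], at the cost of
    shrinking [b] to its meet [q] with the term at [j]. *)
Lemma val_mem_cut w y b c : b <= val_mem w y ->
  (forall (j : dom y) q,
     q <= b -> q <= coef j -> q <= val_eq w (elem j) -> q <= c) ->
  b <= c.
Proof.
move=> bwy bc; apply: (@le_trans _ _ (Order.meet (val_mem w y) b)).
  by rewrite lexI bwy lexx.
apply: bigjoin_meet_le => _ [j _ <-].
apply: (bc j); first exact: leIr.
  by rewrite -meetA leIl.
by rewrite -meetA meetCA leIl.
Qed.

(** Residuation trades [himp] and the infinite meets, which [f] need not preserve, for binary meets
    and joins, which it does preserve. *)
Lemma le_val_eqP x y c :
  c <= val_eq x y <->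
  (forall i : dom x, Order.meet c (coef i) <= val_mem (elem i) y) /\
  (forall j : dom y, Order.meet c (coef j) <= val_mem (elem j) x).
Proof.
rewrite Defs.val_eqE lexI; split=> [/andP[cx cy]|[cx cy]].
  split=> i; rewrite -himpP.
    by apply: le_trans cx _; apply: bigmeet_lb; exists i.
  by apply: le_trans cy _; apply: bigmeet_lb; exists i.
by apply/andP; split; apply: le_bigmeet => _ [i _ <-]; rewrite himpP.
Qed.

Lemma val_eq_coef x y (i : dom x) :
  Order.meet (val_eq x y) (coef i) <= val_mem (elem i) y.
Proof. by have [/(_ i)] := (le_val_eqP x y _).1 (lexx _). Qed.

(** Transitivity is assumed only at elements of [x] and [y], so that an induction hypothesis can
    supply it. *)
Lemma val_mem_eqr_of_trans w x y :
  (forall (i : dom x) (j : dom y),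
     Order.meet (val_eq w (elem i)) (val_eq (elem i) (elem j)) <=
     val_eq w (elem j)) ->
  Order.meet (val_mem w x) (val_eq x y) <= val_mem w y.
Proof.
move=> trans; apply: val_mem_cut (leIl _ _) _ => i p pxy pi pwi.
have piy : p <= val_mem (elem i) y.
  apply: le_trans (val_eq_coef _ _).
  by rewrite lexI pi (le_trans pxy) // leIr.
apply: val_mem_cut piy _ => j q qp qj qij.
apply: (le_val_mem qj); apply: le_trans (trans i j).
by rewrite lexI qij (le_trans qp pwi).
Qed.

Lemma val_eq_trans x y z : Order.meet (val_eq x y) (val_eq y z) <= val_eq x z.
Proof.
elim: x y z => X u IH h y z; set x := PreName u h.
apply/le_val_eqP; split=> [i|k].
  apply: le_trans (val_mem_eqr_of_trans (fun j k => IH i (elem j) (elem k))).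
  by rewrite meetAC; apply: leI2 (val_eq_coef _ _) _.
(* [IH] covers chains that start at an element of [x]; going from [z] back to [x] needs chains that
   end there, obtained by symmetry. *)
have IHr (j : dom y) (i : dom x) :
    Order.meet (val_eq (elem k) (elem j)) (val_eq (elem j) (elem i)) <=
    val_eq (elem k) (elem i).
  by rewrite meetC val_eqC (val_eqC (elem k)) (val_eqC (elem k)); apply: IH.
apply: le_trans (val_mem_eqr_of_trans IHr).
rewrite -meetA meetC (val_eqC x) (val_eqC y z).
by apply: leI2 (val_eq_coef _ _) _.
Qed.

Lemma val_mem_eqr w x y : Order.meet (val_mem w x) (val_eq x y) <= val_mem w y.
Proof. by apply: val_mem_eqr_of_trans => i j; apply: val_eq_trans. Qed.

Lemma val_eq_top_l x1 x2 z : val_eq x1 x2 = \top -> val_eq x1 z <= val_eq x2 z.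
Proof.
move=> e; apply: le_trans (val_eq_trans _ x1 _).
by rewrite (val_eqC x2) e meet1x.
Qed.

End ValuationTheory.

Section HeytingMorphism.
Variables (d d' : Order.disp_t).
Variables (H : completeHeytingType d) (H' : completeHeytingType d').
Variable f : H -> H'.
Hypotheses (f_sup : preserves_sups f) (f_inf : preserves_finite_infs f).

Lemma morph_meet a b : f (Order.meet a b) = Order.meet (f a) (f b).
Proof.
rewrite -!bigmeet_pair f_inf; last exact: finite_set2.
by rewrite image_setU !image_set1.
Qed.

Lemma morph_le a b : a <= b -> f a <= f b.
Proof. by move=> /meet_idPl <-; rewrite morph_meet leIr. Qed.

Lemma morph_val_mem_le (w x : prename H) (w' x' : prename H')
    (e : dom x -> dom x') :
  (forall i, coef (e i) = f (coef i)) ->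
  (forall i, f (val_eq w (elem i)) <= val_eq w' (elem (e i))) ->
  f (val_mem w x) <= val_mem w' x'.
Proof.
move=> ef ew; rewrite f_sup; apply: bigjoin_le => _ [_ [i _ <-] <-].
rewrite morph_meet; apply: (le_val_mem (j := e i)); first by rewrite ef leIl.
exact: le_trans (leIr _ _) (ew i).
Qed.

(** The ordinal index of the pairs of elements is absorbed into the union defining [ftilde], which
    gives the form suited to induction on names. *)
Lemma ftilde_inv (x : prename H) (y' : prename H') : ftilde f x y' ->
  exists x' : prename H', val_eq x' y' = \top /\
    exists e : dom x -> dom x',
      [/\ forall i', exists i, e i = i',
          forall i, ftilde f (elem i) (elem (e i)) &
          forall i, coef (e i) = f (coef i)].
Proof.
case: x => X u h [a [_ _ [x' [_ x'y' [e [surj_e ue he]]]]]].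
exists x'; split=> //; exists e; split=> // i.
by exists (name_rank (PreName u h)); apply: ue.
Qed.

Lemma morph_val_eq_le (x z : prename H) (x' z' : prename H') :
  ftilde f x x' -> ftilde f z z' -> f (val_eq x z) <= val_eq x' z'.
Proof.
elim: x z x' z' => X u IH h z x' z'; set x := PreName u h.
move=> /ftilde_inv[x'' [xx' [e [surj_e ue he]]]].
move=> /ftilde_inv[z'' [zz' [g [surj_g vg kg]]]].
(* Since [xx'] and [zz'] have value [\top], it suffices to bound by [val_eq x'' z'']. *)
apply: le_trans (val_eq_top_l z' xx').
rewrite (val_eqC x''); apply: le_trans (val_eq_top_l x'' zz').
rewrite (val_eqC z''); apply/le_val_eqP; split=> [i'|j'].
  (* By surjectivity every clause of the target comes from some [i], and its left side is then the
     image under [f] of the left side of the clause at [i]. *)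
  have [i <-] := surj_e i'; rewrite he -morph_meet.
  apply: le_trans (morph_le (val_eq_coef _ _)) _.
  by apply: (morph_val_mem_le kg) => j; apply: IH.
have [j <-] := surj_g j'; rewrite kg val_eqC -morph_meet.
apply: le_trans (morph_le (val_eq_coef _ _)) _.
apply: (morph_val_mem_le he) => i.
(* Symmetry brings the element of [x] to the left, where the induction takes place. *)
by rewrite val_eqC (val_eqC (elem (g j))); apply: IH.
Qed.

Lemma morph_val_mem (y x : prename H) (y' x' : prename H') :
  ftilde f x x' -> ftilde f y y' -> f (val_mem y x) <= val_mem y' x'.
Proof.
move=> /ftilde_inv[x'' [xx' [e [_ ue he]]]] yy'.
apply: le_trans (val_mem_eqr y' x'' x'); rewrite xx' meetx1.
by apply: (morph_val_mem_le he) => i; apply: morph_val_eq_le.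
Qed.

End HeytingMorphism.

Theorem theorem3p8 (d d' : Order.disp_t)
    (H : completeHeytingType d) (H' : completeHeytingType d') (f : H -> H')
    (f_sup : preserves_sups f) (f_inf : preserves_finite_infs f)
    (x y z : prename H) (x' y' z' : prename H')
    (xx' : ftilde f x x') (yy' : ftilde f y y') (zz' : ftilde f z z') :
  (f (val_mem y x) <= val_mem y' x')%O /\
  (f (val_eq x z) <= val_eq x' z')%O.
Proof. by split; [apply: morph_val_mem|apply: morph_val_eq_le]. Qed.
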